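(* Let $n \geq 5$ be an integer. Let $G_{\mathrm{pr}}(\mathbb{F}_2^n)$ be the phase-rotation distance graph over $\mathbb{F}_2$, and let $\alpha_3$ denote the $3$-independence number. Then \[ \alpha_3(G_{\mathrm{pr}}(\mathbb{F}_2^n)) \leq \begin{cases} 2^{n-1} \frac{n^2-n+4}{n^2(n+4)} & \text{if } n \equiv 0 \pmod 4, \\ 2^{n-1} \frac{n-3}{(n-1)(n+3)} & \text{if } n \equiv 1 \pmod 4, \\ 2^{n-1} \frac{n-5}{(n+2)(n-2)} & \text{if } n \equiv 2 \pmod 4, \\ 2^{n-1} \frac{1}{n+1} & \text{if } n \equiv 3 \pmod 4. \end{cases} \]
   Context: Let $q$ be a prime power (here $q=2$). Let $\mathbf{e}_1,\ldots,\mathbf{e}_n$ be the standard basis of $\mathbb{F}_q^n$ and $\mathbf{1}$ the all-ones vector. Put $F_i=\mathrm{span}(\mathbf{e}_i)$ for $i=1,\ldots,n$ and $F_{n+1}=\mathrm{span}(\mathbf{1})$. The phase-rotation weight of $\mathbf{x}\in\mathbb{F}_q^n$ is $w_{\mathrm{pr}}(\mathbf{x})=\min\{|I| : I\subseteq\{1,\ldots,n+1\},\ \mathbf{x}\in\mathrm{span}(\bigcup_{i\in I}F_i)\}$, and the phase-rotation distance is $d_{\mathrm{pr}}(\mathbf{x},\mathbf{y})=w_{\mathrm{pr}}(\mathbf{x}-\mathbf{y})$. The phase-rotation distance graph $G_{\mathrm{pr}}(\mathbb{F}_q^n)$ is the graph with vertex set $\mathbb{F}_q^n$ in which $\mathbf{x},\mathbf{y}$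 are adjacent if and only if $d_{\mathrm{pr}}(\mathbf{x},\mathbf{y})=1$. For a graph $G$, the $k$-independence number $\alpha_k(G)$ is the size of the largest set of vertices such that any two distinct vertices in the set are at geodesic distance greater than $k$ in $G$. *)

(* Defs.v *)
From HB Require Import structures.
From mathcomp Require Import all_boot all_order all_algebra.

Set Implicit Arguments.
Unset Strict Implicit.
Unset Printing Implicit Defensive.

Import Order.TTheory GRing.Theory Num.Theory.
Local Open Scope ring_scope.

Section GraphDistance.
Variables (T : finType) (e : rel T).

Definition walk (m : nat) (x y : T) : bool :=
  [exists p : m.-tuple T, path e x p && (last x p == y)].

(* [None] is the infinite distance.  A shortest walk visits each vertex at
   most once, so searching the lengths below #|T| loses nothing. *)
Definition geodesic (x y : T) : option nat :=
  let d := find (fun m => walk m x y) (iota 0 #|T|) in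
  if (d < #|T|)%N then Some d else None.

Definition farther (k : nat) (x y : T) : bool :=
  if geodesic x y is Some d then (k < d)%N else true.

Definition k_independent (k : nat) (S : {set T}) : bool :=
  [forall x in S, forall y in S, (x != y) ==> farther k x y].

Definition independence_number (k : nat) : nat :=
  \max_(S : {set T} | k_independent k S) #|S|.

Lemma walkP (m : nat) (x y : T) :
  reflect (exists p : seq T, [/\ path e x p, last x p = y & size p = m])
          (walk m x y).
Proof.
apply: (iffP existsP) => [[p /andP[pp /eqP lp]]|[p [pp lp sp]]].
  by exists p; rewrite size_tuple.
have sp' : size p == m by apply/eqP.
by exists (Tuple sp'); rewrite /= pp lp eqxx.
Qed.

Lemma farther_walk (k : nat) (x y : T) :
  farther k x y <-> (forall m, (m <= k)%N -> ~~ walk m x y).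
Proof.
rewrite /farther /geodesic; set P := fun m => _; set s := iota _ _.
have nP m : (m < find P s)%N -> ~~ walk m x y.
  move=> lt_m; have lt_mT : (m < #|T|)%N.
    by rewrite (leq_trans lt_m) // (leq_trans (find_size _ _)) // size_iota.
  by have := before_find 0%N lt_m; rewrite nth_iota // add0n => /negbT.
case: ifPn => lt_d; split.
- by move=> lt_k m le_m; apply: nP; apply: leq_ltn_trans lt_k.
- move=> noW; rewrite ltnNge; apply/negP => /noW/negP[].
  have hs : has P s by rewrite has_find size_iota.
  by have := nth_find 0%N hs; rewrite nth_iota.
- move=> _ m _; apply/walkP => -[p [pp lp _]].
  move: lp; case/shortenP: pp => p' pp' up' _ lp'.
  have lt_p' : (size p' < #|T|)%N.
    by rewrite -[(size p').+1]/(size (x :: p')) -(card_uniqP up') max_card.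
  have /negP[] : ~~ walk (size p') x y.
    by apply: nP; apply: leq_trans lt_p' _; rewrite leqNgt.
  by apply/walkP; exists p'.
- by [].
Qed.

End GraphDistance.

Section PhaseRotation.
Variables (F : finFieldType) (n : nat).
Implicit Types (x y : 'rV[F]_n) (i : 'I_n.+1) (I : {set 'I_n.+1}).

(* Indices are 0-based: [ord_max] carries the line of the all-ones vector, and
   every other index [lift ord_max j], of value j, that of the j-th basis
   vector. *)
Definition pr_space i : {vspace 'rV[F]_n} :=
  if unlift ord_max i is Some j then <[delta_mx 0%R j]>%VS
  else <[const_mx 1%R]>%VS.

Definition pr_span I : {vspace 'rV[F]_n} :=
  <<enum (\bigcup_(i in I) [set v | v \in pr_space i])>>%VS.

(* The default [setT] of the minimum is admissible by [pr_span_setT]. *)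
Definition pr_weight x : nat :=
  #|[arg min_(I < [set: 'I_n.+1] | x \in pr_span I) #|I|]|.

Definition pr_dist x y : nat := pr_weight (x - y).

Definition pr_graph : rel 'rV[F]_n := fun x y => pr_dist x y == 1%N.

Lemma pr_span_setT x : x \in pr_span setT.
Proof.
rewrite (row_sum_delta x); apply: rpred_sum => j _; apply: rpredZ.
apply: memv_span; rewrite mem_enum; apply/bigcupP.
exists (lift ord_max j); rewrite ?inE // /pr_space liftK.
exact: memv_line.
Qed.

Lemma pr_weight_le x I : x \in pr_span I -> (pr_weight x <= #|I|)%N.
Proof.
rewrite /pr_weight; case: arg_minnP => [|J _ minJ /minJ //].
exact: pr_span_setT.
Qed.

Lemma pr_weight_attained x : exists2 I, x \in pr_span I & #|I| = pr_weight x.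
Proof.
rewrite /pr_weight; case: arg_minnP => [|J xJ _]; first exact: pr_span_setT.
by exists J.
Qed.

End PhaseRotation.

(* Main.v *)
(** Over F_2 the phase-rotation graph is the Cayley graph of F_2^n on the n+1
    vectors e_1, ..., e_n, 1.  Its eigenvalues are n+1-4k with
    0 <= k <= (n+1)/2, and for n > 3 it has no triangles, so a closed-walk
    count turns a cubic p(t) = t^3 + a t^2 + b t + c that is nonnegative on
    the spectrum into the ratio bound
      p(n+1) |S| <= 2^n (a (n+1) + c)
    for every set S of vertices pairwise at distance > 3.  With r = n mod 4,
    the cubic is (t - r - 1)(t + 3 - r)(t - m) for r < 3, where r+1 and r-3
    are consecutive members of the progression n+1-4k and m is its least
    eigenvalue (-(n+1) for odd n, -(n-1) for even n), and t^2 (t + n + 1) for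
    r = 3. *)
Require Import Defs.
From HB Require Import structures.
From mathcomp Require Import all_boot all_order all_algebra.
From mathcomp Require Import zify ring lra.

Set Implicit Arguments.
Unset Strict Implicit.
Unset Printing Implicit Defensive.

Import Order.TTheory GRing.Theory Num.Theory.
Local Open Scope ring_scope.

(** * Sums and products of signs; consecutive integers *)

Lemma sum_signE (I : finType) (P : pred I) :
  \sum_i (-1) ^+ P i = #|I|%:R - 2 * #|P|%:R :> rat.
Proof.
rewrite -[#|P|]sum1_card -[#|I|]sum1_card !natr_sum (big_mkcond P) /=.
rewrite mulr_sumr -sumrB; apply: eq_bigr => i _.
by case: (P i); rewrite ?expr1 ?expr0 /=; ring.
Qed.

Lemma prod_signE (I : finType) (P : pred I) :
  \prod_i (-1) ^+ P i = (-1) ^+ #|P| :> rat.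
Proof.
rewrite -[#|P|]sum1_card -prodrXr [RHS]big_mkcond /=.
by apply: eq_bigr => i _; rewrite unfold_in; case: (P i).
Qed.

(** No integer lies strictly between -1 and 0. This yields nonnegativity, on the spectrum, of a
    quadratic whose roots are neighbours in the progression of eigenvalues. *)
Lemma mulr_consecutive_ge0 (m k : nat) :
  0 <= (m%:R - k%:R) * (m%:R - k%:R + 1) :> rat.
Proof.
have [le_km | lt_mk] := leqP k m.
  have : k%:R <= m%:R :> rat by rewrite ler_nat.
  by move=> h; apply: mulr_ge0; lra.
have : m.+1%:R <= k%:R :> rat by rewrite ler_nat.
by rewrite -natr1 => h; apply: mulr_le0; lra.
Qed.

(** * Characters of F_2^n and their orthogonality *)

Section Characters.
Variable n : nat.
Implicit Types u x y z : 'rV['F_2]_n.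

Definition dot u x : 'F_2 := \sum_j u 0 j * x 0 j.
Definition chi u x : rat := (-1) ^+ (dot u x != 0).

Lemma dotDl u v x : dot (u + v) x = dot u x + dot v x.
Proof. by rewrite -big_split; apply: eq_bigr => j _; rewrite mxE mulrDl. Qed.

Lemma dotDr u x y : dot u (x + y) = dot u x + dot u y.
Proof. by rewrite -big_split; apply: eq_bigr => j _; rewrite mxE mulrDr. Qed.

Lemma dot0r u : dot u 0 = 0.
Proof. by apply: big1 => j _; rewrite mxE mulr0. Qed.

Lemma dot0l x : dot 0 x = 0.
Proof. by apply: big1 => j _; rewrite mxE mul0r. Qed.

Lemma dot_deltal j x : dot (delta_mx 0 j) x = x 0 j.
Proof.
rewrite /dot (bigD1 j) //= big1 => [|k /negPf neq_kj].
  by rewrite mxE !eqxx mul1r addr0.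
by rewrite mxE neq_kj andbF mul0r.
Qed.

Lemma dot_deltar u j : dot u (delta_mx 0 j) = u 0 j.
Proof. by rewrite -[RHS]dot_deltal; apply: eq_bigr => k _; rewrite mulrC. Qed.

Lemma signF2D (a b : 'F_2) :
  (-1) ^+ (a + b != 0) = (-1) ^+ (a != 0) * (-1) ^+ (b != 0) :> rat.
Proof.
by case: a b => [[|[|]]] // ? [[|[|]]] // ?; rewrite /= ?mulrNN ?mulr1 ?mul1r.
Qed.

Lemma chiDl u v x : chi (u + v) x = chi u x * chi v x.
Proof. by rewrite /chi dotDl signF2D. Qed.

Lemma chiDr u x y : chi u (x + y) = chi u x * chi u y.
Proof. by rewrite /chi dotDr signF2D. Qed.

Lemma chi0r u : chi u 0 = 1.
Proof. by rewrite /chi dot0r eqxx. Qed.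

Lemma chi0l x : chi 0 x = 1.
Proof. by rewrite /chi dot0l eqxx. Qed.

Lemma natrF2 m : m%:R = (odd m)%:R :> 'F_2.
Proof.
rewrite -[in LHS](odd_double_half m) natrD -mul2n natrM.
by rewrite [2%:R](_ : _ = 0) ?mul0r ?addr0 //; apply: val_inj.
Qed.

Lemma oppF2 x : - x = x.
Proof.
apply/rowP => j; rewrite mxE; case: (x 0 j) => [[|[|]]] // ?; exact: val_inj.
Qed.

Lemma chi_sum u (I : finType) (F : I -> 'rV['F_2]_n) :
  chi u (\sum_i F i) = \prod_i chi u (F i).
Proof. by apply: (big_morph (chi u)) => [x y|]; rewrite (chiDr, chi0r). Qed.

(** If [z] has a nonzero coordinate [j], translating [u] by the [j]-th basis vector flips every
    sign, so the sum equals its own opposite. *)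
Lemma sum_chi z : \sum_u chi u z = if z == 0 then 2 ^+ n else 0.
Proof.
have [-> | nz_z] := eqVneq z 0.
  under eq_bigr do rewrite chi0r.
  by rewrite sumr_const card_mx card_Fp // mul1n natrX.
have [j nz_zj] : exists j, z 0 j != 0.
  apply/existsP; rewrite -negb_forall; apply: contra nz_z => /forallP z0.
  by apply/eqP/rowP => j; rewrite (eqP (z0 j)) mxE.
have: \sum_u chi u z = - \sum_u chi u z; last by lra.
rewrite [LHS](reindex_inj (addIr (delta_mx 0 j))) /= -sumrN.
apply: eq_bigr => u _; rewrite chiDl [X in _ * X]/chi dot_deltal nz_zj.
by rewrite expr1 mulrN1.
Qed.

(** * Generators of the Cayley graph, its eigenvalues and its walks *)

Definition gen (i : 'I_n.+1) : 'rV['F_2]_n :=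
  if unlift ord_max i is Some j then delta_mx 0 j else const_mx 1.

Lemma gen_lift j : gen (lift ord_max j) = delta_mx 0 j.
Proof. by rewrite /gen liftK. Qed.

Lemma gen_max : gen ord_max = const_mx 1.
Proof. by rewrite /gen unlift_none. Qed.

Lemma pr_graph_gen x i : gen i != 0 -> pr_graph x (x + gen i).
Proof.
move=> nz_g; rewrite /pr_graph /pr_dist opprD addNKr oppF2 eqn_leq lt0n.
apply/andP; split.
  apply: (@leq_trans #|[set i]|); last by rewrite cards1.
  apply: pr_weight_le; apply: memv_span.
  rewrite mem_enum; apply/bigcupP; exists i; rewrite !inE //.
  by rewrite /gen /pr_space; case: unlift => [j|]; exact: memv_line.
apply: contra nz_g => /eqP w0.
have [I + /eqP] := pr_weight_attained (gen i).
rewrite w0 cards_eq0 => gI /eqP I0; move: gI.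
by rewrite I0 /pr_span big_set0 enum_set0 span_nil memv0.
Qed.

(** The eigenvalue of the Cayley graph at the eigenvector [chi u]. *)
Definition theta u : rat := \sum_i chi u (gen i).

Lemma sum_gen : \sum_i gen i = 0.
Proof.
rewrite (bigD1_ord ord_max) //= gen_max.
under eq_bigr do rewrite gen_lift.
apply/rowP => j; rewrite !mxE summxE (bigD1 j) //= big1 => [|k /negPf neq_kj].
  by rewrite mxE !eqxx addr0; apply: val_inj.
by rewrite mxE eq_sym neq_kj andbF.
Qed.

Lemma theta0 : theta 0 = n.+1%:R.
Proof.
rewrite /theta; under eq_bigr do rewrite chi0l.
by rewrite sumr_const card_ord.
Qed.

(* The generators add up to zero, so evenly many of them have character -1. *)
Lemma thetaE u : exists2 k, (k.*2 <= n.+1)%N & theta u = n.+1%:R - 4 * k%:R.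
Proof.
pose P := [pred i | dot u (gen i) != 0].
have /esym := prod_signE P; rewrite -chi_sum sum_gen chi0r -signr_odd.
case oddP: (odd #|P|) => // _.
have cardP : #|P| = (#|P|./2).*2 by rewrite even_halfK ?oddP.
move: (#|P|./2) cardP => k cardP.
exists k; first by rewrite -cardP (leq_trans (max_card _)) ?card_ord.
rewrite /theta (sum_signE P) card_ord cardP -mul2n natrM; ring.
Qed.

(** By Fourier inversion this is [2 ^+ n] times the number of sequences of [m] generators with sum
    [z]. *)
Definition moment m z : rat := \sum_u theta u ^+ m * chi u z.

Lemma moment0 z : moment 0 z = if z == 0 then 2 ^+ n else 0.
Proof. by rewrite -sum_chi; apply: eq_bigr => u _; rewrite mul1r. Qed.

Lemma momentS m z : moment m.+1 z = \sum_i moment m (z + gen i).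
Proof.
rewrite exchange_big /=; apply: eq_bigr => u _.
rewrite exprSr -mulrA mulr_suml mulr_sumr.
by apply: eq_bigr => i _; rewrite chiDr (mulrC (chi u z)).
Qed.

(** A nonzero moment has a nonzero term in the recursion [momentS], and the index of that term is
    the first step of a walk. *)
Lemma walk_moment m x y :
  (forall i, gen i != 0) -> moment m (x - y) != 0 -> walk (@pr_graph 'F_2 n) m x y.
Proof.
move=> nz_g; elim: m x => [|m IHm] x.
  rewrite moment0 subr_eq0; case: ifP; rewrite ?eqxx // => /eqP-> _.
  by apply/walkP; exists [::].
rewrite momentS => nz_sum.
have [i nz_i] : exists i, moment m (x - y + gen i) != 0.
  apply/existsP; rewrite -negb_forall; apply: contra nz_sum => /forallP z0.
  by rewrite big1 // => i _; apply/eqP/z0.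
have /walkP[p [pp lp sp]] : walk (@pr_graph 'F_2 n) m (x + gen i) y.
  by apply: IHm; rewrite addrAC.
by apply/walkP; exists (x + gen i :: p); rewrite /= pr_graph_gen // pp lp sp.
Qed.

(** * Short relations among the generators and the ratio bound *)

Hypothesis n_gt3 : (3 < n)%N.

(* Some linear form takes the value 1 on all three generators: the sum of all
   coordinates if n is odd, and of all coordinates but one if n is even. *)
Lemma gen_sum3_neq0 i j k : gen i + gen j + gen k != 0.
Proof.
pose s := [:: i; j; k].
(* Three indices cannot cover more than three basis vectors; the coordinate dropped from the form
   when [n] is even must avoid all of them. *)
have [h h_s] : exists h : 'I_n, lift ord_max h \notin s.
  apply/existsP; apply: contraLR n_gt3 => /existsPn all_s; rewrite -leqNgt.
  rewrite -[n in (n <= _)%N]card_ord -(card_image (@lift_inj _ ord_max)).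
  apply: leq_trans (card_size s); apply: subset_leq_card; apply/subsetP.
  by move=> l /imageP[h _ ->]; move: (all_s h); rewrite negbK.
pose u : 'rV['F_2]_n := const_mx 1 - (if odd n then 0 else delta_mx 0 h).
have u1 l : l \in s -> dot u (gen l) = 1.
  case: (unliftP ord_max l) => [m | ] -> ls.
    rewrite gen_lift dot_deltar !mxE; case: ifP => _; rewrite !mxE ?subr0 //.
    rewrite eqxx /=; case: eqP => [eq_mh | _]; last by rewrite subr0.
    by rewrite -eq_mh ls in h_s.
  have dot11 : dot (const_mx 1) (const_mx 1) = (odd n)%:R.
    rewrite -natrF2 -[n in n%:R]card_ord -sumr_const.
    by apply: eq_bigr => m _; rewrite !mxE mulr1.
  rewrite gen_max dotDl dot11 (fun_if (@GRing.opp _)) (fun_if (dot^~ _)) oppr0.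
  rewrite oppF2 dot0l dot_deltal mxE.
  by case: (odd n); rewrite ?addr0 ?add0r.
apply/eqP => /(congr1 (dot u)); rewrite !dotDr !u1 ?inE ?eqxx ?orbT // dot0r.
by move/eqP.
Qed.

(** In characteristic 2 a vector is the sum of three copies of itself. *)
Lemma gen_neq0 i : gen i != 0.
Proof.
by have := gen_sum3_neq0 i i i; rewrite -[X in X + _ + _]oppF2 addNr add0r.
Qed.

Lemma gen_inj : injective gen.
Proof.
suff max_lift h : gen ord_max <> gen (lift ord_max h).
  move=> i j.
  case: (unliftP ord_max i) (unliftP ord_max j) => [h|] -> [k|] -> // eq_g.
  - move/rowP/(_ h): eq_g; rewrite !gen_lift !mxE !eqxx /=.
    by case: eqP => [-> | _ /eqP].
  - by case: (max_lift h).
  - by case: (max_lift k).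
(* At any coordinate other than [h], the all-ones vector has entry 1 and the [h]-th basis vector has
   entry 0. *)
have [k neq_kh] : exists k : 'I_n, k != h.
  apply/existsP; apply: contraLR n_gt3 => /existsPn all_h; rewrite -leqNgt.
  rewrite -[n in (n <= _)%N]card_ord.
  apply: (@leq_trans #|[set h]|); last by rewrite cards1.
  apply: subset_leq_card; apply/subsetP => k _.
  by move: (all_h k); rewrite negbK inE.
rewrite gen_max gen_lift => /rowP/(_ k); rewrite !mxE (negPf neq_kh) andbF.
by move/eqP.
Qed.

(** Closed walks of length 1 or 3 would give a vanishing sum of one or three generators; a closed
    walk of length 2 repeats one generator, since these are distinct. *)
Lemma moment_at0 :
  [/\ moment 0 0 = 2 ^+ n, moment 1 0 = 0,
      moment 2 0 = 2 ^+ n * n.+1%:R & moment 3 0 = 0].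
Proof.
split.
- by rewrite moment0 eqxx.
- rewrite momentS big1 // => i _.
  by rewrite moment0 add0r (negPf (gen_neq0 i)).
- rewrite momentS -[in RHS](card_ord n.+1) -sum1_card natr_sum mulr_sumr.
  apply: eq_bigr => i _; rewrite momentS (bigD1 i) //= big1 => [|j neq_ji].
    by rewrite moment0 add0r -{1}[gen i]oppF2 addNr eqxx addr0 mulr1.
  rewrite moment0 add0r -{1}[gen i]oppF2 addrC subr_eq0 (inj_eq gen_inj).
  by rewrite (negPf neq_ji).
- rewrite momentS big1 // => i _; rewrite momentS big1 // => j _.
  rewrite momentS big1 // => k _.
  by rewrite moment0 add0r (negPf (gen_sum3_neq0 i j k)).
Qed.

(** The sum of [p (theta u) * f u ^+ 2], with [f] the Fourier transform of the indicator of [S], is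
    evaluated exactly through moments and bounded below by its term at [u = 0]. *)
Lemma cubic_ratio_bound (a b c : rat) (S : {set 'rV['F_2]_n})
    (p := fun t => t ^+ 3 + a * t ^+ 2 + b * t + c) :
    k_independent (@pr_graph 'F_2 n) 3 S ->
    0 <= a * n.+1%:R + c ->
    (forall k, (k.*2 <= n.+1)%N -> 0 <= p (n.+1%:R - 4 * k%:R)) ->
  p n.+1%:R * #|S|%:R <= 2 ^+ n * (a * n.+1%:R + c).
Proof.
move=> indS W_ge0 p_ge0.
have [-> | S_gt0] := posnP #|S|; first by rewrite mulr0 mulr_ge0 ?exprn_ge0.
have {}S_gt0 : 0 < #|S|%:R :> rat by rewrite ltr0n.
pose f u := \sum_(x in S) chi u x.
pose Q z := moment 3 z + a * moment 2 z + b * moment 1 z + c * moment 0 z.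
have QE z : \sum_u p (theta u) * chi u z = Q z.
  rewrite /Q /moment !mulr_sumr -!big_split /=.
  by apply: eq_bigr => u _; rewrite /p expr0 expr1; ring.
have Q0 : Q 0 = 2 ^+ n * (a * n.+1%:R + c).
  by rewrite /Q; case: moment_at0 => -> -> -> ->; ring.
(* A nonzero moment of order at most 3 would produce a walk of length at most 3 between two points
   of [S]. *)
have Qneq x y : x \in S -> y \in S -> x != y -> Q (x - y) = 0.
  move=> xS yS neq_xy.
  have /forall_inP/(_ y yS)/implyP/(_ neq_xy) := forall_inP indS x xS.
  move=> /farther_walk no_walk.
  have mom0 m : (m <= 3)%N -> moment m (x - y) = 0.
    move=> /no_walk/negP noW; apply/eqP/negPn/negP => /(walk_moment gen_neq0).
    exact: noW.
  by rewrite /Q !mom0 //; ring.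
have energy : \sum_u p (theta u) * f u ^+ 2 = #|S|%:R * Q 0.
  transitivity (\sum_(x in S) \sum_(y in S) Q (x - y)).
    under [RHS]eq_bigr do under eq_bigr do rewrite -QE.
    under [RHS]eq_bigr do rewrite exchange_big.
    rewrite exchange_big /=; apply: eq_bigr => u _.
    rewrite /f expr2 mulr_suml mulr_sumr; apply: eq_bigr => x _.
    rewrite !mulr_sumr; apply: eq_bigr => y _.
    by rewrite chiDr oppF2.
  rewrite -sum1_card natr_sum mulr_suml; apply: eq_bigr => x xS.
  rewrite (bigD1 x) //= big1 => [|y /andP[yS neq_yx]].
    by rewrite subrr addr0 mul1r.
  by rewrite Qneq // eq_sym.
rewrite -(ler_pM2l S_gt0) -Q0 -energy (bigD1 0) //= theta0.
have -> : f 0 = #|S|%:R.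
  by rewrite /f; under eq_bigr do rewrite chi0l; rewrite sumr_const.
rewrite expr2 mulrA (mulrC #|S|%:R) lerDl.
apply: sumr_ge0 => u _; apply: mulr_ge0; last exact: sqr_ge0.
by have [k le_k ->] := thetaE u; apply: p_ge0.
Qed.

End Characters.

(** * The closed forms for the four residue classes *)

Lemma independence_number_attained (T : finType) (e : rel T) k :
  exists2 S, k_independent e k S & #|S| = independence_number e k.
Proof.
rewrite /independence_number; elim/big_ind: _ => [|s t [S ? <-] [S' ? <-]|S ?].
- by exists set0; rewrite ?cards0 //; apply/forall_inP => x; rewrite inE.
- by rewrite /maxn; case: ifP => _; [exists S' | exists S].
- by exists S.
Qed.

(** Cancels the factor [c] common to both sides of a ratio bound, and absorbs the 2 into the power
    of two. *)
Lemma le_half_ratio (n : nat) (s A B c : rat) : (0 < n)%N -> 0 < B -> 0 < c ->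
  (2 * B * c) * s <= 2 ^+ n * (A * c) -> s <= 2 ^+ (n - 1) * (A / B).
Proof.
move=> n_gt0 B_gt0 c_gt0 le_s; rewrite mulrA ler_pdivlMr //.
have c2_gt0 : 0 < 2 * c by rewrite mulr_gt0.
rewrite -(ler_pM2l c2_gt0).
have -> : 2 * c * (s * B) = 2 * B * c * s by ring.
have -> : 2 * c * (2 ^+ (n - 1) * A) = 2 ^+ n * (A * c); last exact: le_s.
by rewrite -[in 2 ^+ n](subnK n_gt0) addn1 exprS; ring.
Qed.

Theorem theorem46 (n : nat) (hn : (5 <= n)%N) :
  let alpha3 : rat := (independence_number (@pr_graph 'F_2 n) 3)%:R in
  let N : rat := n%:R in
  alpha3 <=
    match (n %% 4)%N with
    | 0%N => 2 ^+ (n - 1) * ((N ^+ 2 - N + 4) / (N ^+ 2 * (N + 4)))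
    | 1%N => 2 ^+ (n - 1) * ((N - 3) / ((N - 1) * (N + 3)))
    | 2%N => 2 ^+ (n - 1) * ((N - 5) / ((N + 2) * (N - 2)))
    | _ => 2 ^+ (n - 1) * (1 / (N + 1))
    end.
Proof.
lazy zeta; set N : rat := n%:R.
have [S indS <-] := independence_number_attained (@pr_graph 'F_2 n) 3.
have N_ge5 : 5 <= N by rewrite ler_nat.
have n_gt0 : (0 < n)%N by lia.
have bound a b c := @cubic_ratio_bound n (ltnW hn) a b c S indS.
rewrite -natr1 -/N in bound.
have N_mod : N = 4 * (n %/ 4)%:R + (n %% 4)%:R.
  by rewrite /N {1}(divn_eq n 4) natrD natrM mulrC.
have theta_ge k : (k.*2 <= n.+1)%N -> 0 <= N + 1 - 4 * k%:R + (N + 1).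
  rewrite -(ler_nat rat) -mul2n natrM -natr1 -/N; lra.
(* For even [n] the bound on the even number [k.*2] improves to [n], which raises the least
   eigenvalue to -(n-1). *)
have theta_ge_even k : ~~ odd n -> (k.*2 <= n.+1)%N ->
    0 <= N + 1 - 4 * k%:R + (N - 1).
  move=> even_n le_k; have: (k.*2 <= n)%N by lia.
  rewrite -(ler_nat rat) -mul2n natrM -/N; lra.
(* With n = 4q + r the two factors are 4(q - k) and 4(q - k + 1). *)
have theta_quad r k (th := N + 1 - 4 * k%:R) : N = 4 * (n %/ 4)%:R + r ->
    0 <= (th - (r + 1)) * (th + (3 - r)).
  move=> Nr; have := mulr_consecutive_ge0 (n %/ 4) k.
  rewrite /th Nr => ge0; set q := (X in 0 <= X).
  have -> : q = 16 * (((n %/ 4)%:R - k%:R) * ((n %/ 4)%:R - k%:R + 1)).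
    by rewrite /q; ring.
  by rewrite mulr_ge0.
(* Ratio bound for p(t) = (t - r - 1)(t + 3 - r)(t + d), where -d bounds the spectrum from below;
   [a], [b], [c] are the coefficients of its expansion. *)
have bound_quad r d : N = 4 * (n %/ 4)%:R + r ->
    (forall k, (k.*2 <= n.+1)%N -> 0 <= N + 1 - 4 * k%:R + d) ->
    0 <= (2 - 2 * r + d) * (N + 1) - (r + 1) * (3 - r) * d ->
  (N - r) * (N + 4 - r) * (N + 1 + d) * #|S|%:R
    <= 2 ^+ n * ((2 - 2 * r + d) * (N + 1) - (r + 1) * (3 - r) * d).
  move=> Nr d_ge W_ge0.
  set a := 2 - 2 * r + d; pose b := (2 - 2 * r) * d - (r + 1) * (3 - r).
  pose c := - ((r + 1) * (3 - r) * d).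
  have -> : (N - r) * (N + 4 - r) * (N + 1 + d)
      = (N + 1) ^+ 3 + a * (N + 1) ^+ 2 + b * (N + 1) + c.
    by rewrite /a /b /c; ring.
  apply: (bound a b c W_ge0) => k le_k.
  have := mulr_ge0 (theta_quad r k Nr) (d_ge k le_k).
  by congr (0 <= _); rewrite /a /b /c; ring.
case def_r: (n %% 4)%N N_mod => [|[|[|r]]] N_mod.
- have W_ge0 : 0 <= N ^+ 2 - N + 4 by nra.
  have := bound_quad 0 (N - 1) N_mod.
  have -> : (2 - 2 * 0 + (N - 1)) * (N + 1) - (0 + 1) * (3 - 0) * (N - 1)
    = (N ^+ 2 - N + 4) * 1 by ring.
  have -> : (N - 0) * (N + 4 - 0) * (N + 1 + (N - 1))
    = 2 * (N ^+ 2 * (N + 4)) * 1 by ring.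
  rewrite !mulr1 => /(_ _ W_ge0) le_S.
  apply: (@le_half_ratio n _ _ _ 1); rewrite ?mulr_gt0 ?exprn_gt0 ?mulr1 //; try lra.
  by apply: le_S => k; apply: theta_ge_even; lia.
(* Here d = N + 1, and the factor N + 1 cancels. *)
- have W_ge0 : 0 <= (N - 3) * (N + 1) by rewrite mulr_ge0 //; lra.
  have := bound_quad 1 (N + 1) N_mod.
  have -> : (2 - 2 * 1 + (N + 1)) * (N + 1) - (1 + 1) * (3 - 1) * (N + 1)
    = (N - 3) * (N + 1) by ring.
  have -> : (N - 1) * (N + 4 - 1) * (N + 1 + (N + 1))
    = 2 * ((N - 1) * (N + 3)) * (N + 1) by ring.
  move=> /(_ theta_ge W_ge0) le_S.
  by apply: le_half_ratio le_S; rewrite ?mulr_gt0 //; lra.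
(* Here d = N - 1, and the factor N cancels; the sign of N - 5 comes from n >= 5. *)
- have W_ge0 : 0 <= (N - 5) * N by rewrite mulr_ge0 //; lra.
  have := bound_quad 2 (N - 1) N_mod.
  have -> : (2 - 2 * 2 + (N - 1)) * (N + 1) - (2 + 1) * (3 - 2) * (N - 1)
    = (N - 5) * N by ring.
  have -> : (N - 2) * (N + 4 - 2) * (N + 1 + (N - 1))
    = 2 * ((N + 2) * (N - 2)) * N by ring.
  move=> /(_ _ W_ge0) le_S.
  apply: (@le_half_ratio n _ _ _ N); rewrite ?mulr_gt0 //; try lra.
  by apply: le_S => k; apply: theta_ge_even; lia.
(* The cubic t^2 (t + N + 1) takes the value 2 (N + 1)^3 at N + 1, so (N + 1)^2 cancels. *)
- have := bound (N + 1) 0 0.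
  have -> : (N + 1) * (N + 1) + 0 = 1 * (N + 1) ^+ 2 by ring.
  have -> : (N + 1) ^+ 3 + (N + 1) * (N + 1) ^+ 2 + 0 * (N + 1) + 0
    = 2 * (N + 1) * (N + 1) ^+ 2 by ring.
  move=> le_S; apply: (@le_half_ratio n _ _ _ ((N + 1) ^+ 2)) => //.
  + by lra.
  + by rewrite exprn_gt0 //; lra.
  apply: le_S => [|k le_k]; first by rewrite mul1r sqr_ge0.
  have := mulr_ge0 (sqr_ge0 (N + 1 - 4 * k%:R)) (theta_ge k le_k).
  by congr (0 <= _); ring.
Qed.
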